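(* Let $\mathfrak{F}$ be a hereditary formation (of finite groups) and let $G$ be a finite group. Let $S_\mathfrak{F}(G)$ (respectively $C_\mathfrak{F}(G)$) be the intersection of all weak $K$-$\mathfrak{F}$-subnormalizers in $G$ of all Sylow subgroups (respectively of all cyclic primary subgroups) of $G$. Then: (1) $S_\mathfrak{F}(G)$ is the largest subgroup among the normal subgroups $N$ of $G$ such that $P$ is $K$-$\mathfrak{F}$-subnormal in $PN$ for every Sylow subgroup $P$ of $G$. (2) $C_\mathfrak{F}(G)$ is the largest subgroup among the normal subgroups $N$ of $G$ such that $C$ is $K$-$\mathfrak{F}$-subnormal in $CN$ for every cyclic primary subgroup $C$ of $G$.
   Context: All groups are finite. A formation is a class of groups (closed under isomorphism) closed under taking epimorphic images and subdirect products; it is hereditary if it is closed under taking subgroups. A cyclic primary subgroup is a cyclic subgroup of prime power order. For a formation $\mathfrak{F}$, a subgroup $H$ of $G$ is $K$-$\mathfrak{F}$-subnormal in $G$ if there is a chain $H=H_0\subseteq H_1\subseteq\dots\subseteq H_n=G$ of subgroups such that for each $i=1,\dots,n$ either $H_{i-1}\trianglelefteq H_i$ or $H_i/\mathrm{Core}_{H_i}(H_{i-1})\in\mathfrak{F}$. A subgroup $T$ of $G$ is a weak $K$-$\mathfrak{F}$-subnormalizer of a subgroup $H$ in $G$ if $H$ is $K$-$\mathfrak{F}$-subnormal in $T$ and, whenever $H$ is $K$-$\mathfrak{F}$-subnormal in $M\leq G$ and $T\leq M$, then $T=M$. *)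

(* Defs.v *)
From mathcomp Require Import all_boot all_fingroup all_solvable boolp.

Set Implicit Arguments.
Unset Strict Implicit.
Unset Printing Implicit Defensive.

Local Open Scope group_scope.

Definition group_class := forall gT : finGroupType, {group gT} -> Prop.

(* For subdirect products it is enough to ask closure for two factors, since
   longer nonempty finite subdirect products are obtained by iteration. The empty class
   is not excluded. *)
Definition formation (F : group_class) : Prop :=
  [/\ forall (aT rT : finGroupType) (G : {group aT}) (H : {group rT}),
        G \isog H -> F aT G -> F rT H,
      forall (aT rT : finGroupType) (G : {group aT})
             (f : {morphism G >-> rT}),
        F aT G -> F rT (f @* G)%G
    & forall (aT bT : finGroupType) (A : {group aT}) (B : {group bT})
             (H : {group (aT * bT)}),
        fst @: H = A -> snd @: H = B ->
        F aT A -> F bT B -> F _ H].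

Definition hereditary (F : group_class) : Prop :=
  forall (gT : finGroupType) (G H : {group gT}),
    H \subset G -> F gT G -> F gT H.

Section Subnormality.

Variables (F : group_class) (gT : finGroupType).
Implicit Types G H M N P T : {group gT}.

Definition KF_subnormal H G : Prop :=
  exists (n : nat) (c : nat -> {group gT}),
    [/\ c 0 = H, c n = G
      & forall i, i < n ->
          c i \subset c i.+1 /\
          (c i <| c i.+1 \/ F (c i.+1 / gcore (c i) (c i.+1))%G)].

Definition weak_KF_subnormalizer G H T : Prop :=
  [/\ T \subset G, KF_subnormal H T
    & forall M, M \subset G -> KF_subnormal H M -> T \subset M -> T = M].

(* A prime p need not divide #|G|, so the trivial subgroup is both a Sylow and
   a cyclic primary subgroup of G; being normal in every subgroup of G, its
   only effect below is that the intersections are over nonempty families. *)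
Definition Sylow_subgroup G P : Prop :=
  exists2 p : nat, prime p & p.-Sylow(G) P.

Definition cyclic_primary_subgroup G P : Prop :=
  [/\ P \subset G, cyclic P & exists2 p : nat, prime p & p.-group P].

(* The unique weak KF-subnormalizer of the trivial subgroup of G is G, so when
   X 1 holds this bigcap, whose neutral element is all of gT, lies in G. *)
Definition cap_weak_KF_subnormalizers (X : {group gT} -> Prop) G
    : {group gT} :=
  [group of \bigcap_(T : {group gT} |
     `[< exists2 H : {group gT}, X H & weak_KF_subnormalizer G H T >]) T].

Definition S_F G := cap_weak_KF_subnormalizers (Sylow_subgroup G) G.

Definition C_F G := cap_weak_KF_subnormalizers (cyclic_primary_subgroup G) G.

(* P <*> N is the product P * N, as N is normal in G (norm_joinEl). *)
Definition KF_subnormal_in_products (X : {group gT} -> Prop) G N : Prop :=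
  N <| G /\ forall P, X P -> KF_subnormal P (P <*> N)%G.

Definition largest (Q : {group gT} -> Prop) N : Prop :=
  Q N /\ forall M, Q M -> M \subset N.

End Subnormality.

(* Main.v *)
Require Import Defs.
From mathcomp Require Import all_boot all_fingroup all_solvable boolp.

(** A KF-subnormal chain stays one when it is intersected with a subgroup,
    multiplied by a normal subgroup, or conjugated.  Hence, if [N] is a normal
    subgroup of [G] with [P] KF-subnormal in [PN], and [T] is a weak
    KF-subnormalizer of [P], then [P] is KF-subnormal in [PN], which is
    KF-subnormal in [TN], so that [T = TN] contains [N] by maximality.  The
    intersection of all the weak KF-subnormalizers is normal, and it satisfies
    the condition defining such [N], because [P] is KF-subnormal in any subgroup
    of [T] that contains [P]. *)

Local Open Scope group_scope.

Definition KF_step (F : group_class) {gT : finGroupType} (H K : {group gT}) :=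
  H \subset K /\ (H <| K \/ F _ (K / gcore H K)%G).

Lemma formation_homg {F : group_class} {aT rT : finGroupType}
    {G : {group aT}} {H : {group rT}} :
  formation F -> H \homg G -> F _ G -> F _ H.
Proof.
case=> _ Fim _ /homgP[f fG] FG.
have -> : H = (f @* G)%G by apply/val_inj.
exact: Fim.
Qed.

(** With [C] the core of [H] in [K], heredity puts [(K :&: L) / C], a subgroup of [K / C], in [F].
    By the second isomorphism theorem it is [(K :&: L) / (K :&: L :&: C)], which maps onto the
    required quotient because [K :&: L :&: C] lies in the core of [H :&: L]. *)
Lemma KF_stepI {F : group_class} {gT : finGroupType} (L : {group gT})
    {H K : {group gT}} :
  formation F -> hereditary F -> KF_step F H K ->
  KF_step F (H :&: L)%G (K :&: L)%G.
Proof.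
move=> formF herF [sHK stepHK]; split; first exact: setSI.
case: stepHK => [nHK | FK]; [left | right].
  rewrite /normal setSI //=; apply: normsI.
    by rewrite subIset // normal_norm.
  by rewrite subIset // normG orbT.
set C := gcore H K in FK; have nCK : K \subset 'N(C) := gcore_norm H K.
have nCKL : K :&: L \subset 'N(C) by rewrite subIset ?nCK.
have FKL : F _ ((K :&: L) / C)%G by apply: herF FK; rewrite quotientS ?subsetIl.
have nIKL : K :&: L \subset 'N(K :&: L :&: C) by rewrite normsI ?normG.
apply: (formation_homg formF _ FKL).
apply: (homg_trans (B := (K :&: L) / (K :&: L :&: C))).
  apply: homg_quotientS => //; first exact: gcore_norm.
  apply: gcore_max => //=.
  rewrite subsetI (subset_trans (subsetIr _ _)) ?gcore_sub //=.
  by rewrite -setIA subIset // subIset ?subxx // orbT.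
by rewrite setIC; apply/isog_hom/second_isog.
Qed.

(** With [C] the core of [H] in [K], the subgroup [C <*> N] is normalized by [K <*> N] and lies in
    [H <*> N], hence in its core. So the required quotient is an image of [K / C]. *)
Lemma KF_stepY {F : group_class} {gT : finGroupType} {G N H K : {group gT}} :
  formation F -> N <| G -> K \subset G -> KF_step F H K ->
  KF_step F (H <*> N)%G (K <*> N)%G.
Proof.
move=> formF nNG sKG [sHK stepHK]; split; first exact: genS (setSU _ _).
have nNK : K \subset 'N(N) := subset_trans sKG (normal_norm nNG).
have nNH := subset_trans sHK nNK.
have sN L : N \subset L <*> N := joing_subr L N.
case: stepHK => [nHK | FK]; [left | right].
  rewrite /normal genS ?setSU //= join_subG normsY ?(normal_norm nHK) //=.
  by rewrite (subset_trans (sN H)) ?normG.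
set C := gcore H K in FK; have nCK : K \subset 'N(C) := gcore_norm H K.
have sCH : C \subset H := gcore_sub H K.
have nCNK : K \subset 'N(C <*> N) by rewrite normsY.
have nCNKN : K <*> N \subset 'N(C <*> N).
  by rewrite join_subG nCNK (subset_trans (sN C)) ?normG.
apply: (formation_homg formF _ FK).
apply: (homg_trans (B := K <*> N / (C <*> N))).
  apply: homg_quotientS => //; first exact: gcore_norm.
  by apply: gcore_max => //; rewrite genS ?setSU.
(* [K] need not contain [C <*> N]: the right side is the image of [K], and [K] together with
   [C <*> N] generates [K <*> N]. *)
have -> : (K <*> N) / (C <*> N) = K / (C <*> N).
  rewrite -(quotientYidr nCNK) /= joingA.
  by rewrite (joing_idPl (subset_trans sCH sHK)).
by apply: homg_quotientS => //; exact: joing_subl.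
Qed.

Lemma KF_stepJ {F : group_class} {gT : finGroupType} (x : gT)
    {H K : {group gT}} :
  formation F -> KF_step F H K -> KF_step F (H :^ x)%G (K :^ x)%G.
Proof.
move=> formF [sHK stepHK]; split; first by rewrite conjSg.
case: stepHK => [nHK | FK]; [left | right]; first by rewrite normalJ.
set C := gcore H K in FK; have nCK : K \subset 'N(C) := gcore_norm H K.
have sCH : C \subset H := gcore_sub H K.
have nsCK : C <| K := gcore_normal sHK.
apply: (formation_homg formF _ FK).
apply: (homg_trans (B := K :^ x / (C :^ x))).
  apply: homg_quotientS; rewrite ?normJ ?conjSg //; first exact: gcore_norm.
  by apply: gcore_max; rewrite ?normJ ?conjSg.
(* Seen as a morphism on [K], conjugation by [x] induces a map from [K / C] onto
   [K :^ x / C :^ x]. *)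
have conjE (A : {set gT}) : A \subset K -> A :^ x = conjgm K x @* A.
  by move=> sAK; rewrite morphim_conj (setIidPr sAK).
rewrite (conjE K) // (conjE C) ?normal_sub // -(morphim_quotm _ nsCK).
exact: morphim_homg.
Qed.

(** Transfers the one-step lemmas to whole chains. The bound [K \subset A] is what lets [KF_stepY]
    apply, since there [K] must normalize [N]. *)
Lemma KF_subnormal_map {F : group_class} {aT rT : finGroupType}
    (phi : {group aT} -> {group rT}) (A H : {group aT}) :
  (forall L K : {group aT}, K \subset A ->
     KF_step F L K -> KF_step F (phi L) (phi K)) ->
  KF_subnormal F H A -> KF_subnormal F (phi H) (phi A).
Proof.
move=> phiP [n [c [<- cn step]]]; exists n, (phi \o c).
split=> //= [|i lt_i_n]; first by rewrite cn.
apply: phiP; last exact: step.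
(* The inclusion is known at the top of the chain, so the induction descends from index [n]. *)
suff sub j : j <= n -> c (n - j) \subset A.
  by rewrite -(subKn lt_i_n) sub ?leq_subr.
elim: j => [|j IHj] lt_j_n; first by rewrite subn0 cn.
apply: subset_trans (IHj (ltnW lt_j_n)).
have [|sub_c _] := step (n - j.+1).
  by rewrite ltn_subrL (leq_trans _ lt_j_n).
by rewrite subnSK in sub_c.
Qed.

Lemma KF_subnormal_sub {F : group_class} {gT : finGroupType}
    {H G : {group gT}} :
  KF_subnormal F H G -> H \subset G.
Proof.
case=> n [c [<- <- step]].
elim: n step => [|n IHn] step //.
have [sub_c _] := step n (ltnSn n).
by apply: subset_trans sub_c; apply: IHn => i lt_in; apply/step/ltnW.
Qed.

Lemma KF_subnormal_refl {F : group_class} {gT : finGroupType} (H : {group gT}) :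
  KF_subnormal F H H.
Proof. by exists 0, (fun=> H). Qed.

Lemma KF_subnormal_trans {F : group_class} {gT : finGroupType}
    {H K L : {group gT}} :
  KF_subnormal F H K -> KF_subnormal F K L -> KF_subnormal F H L.
Proof.
move=> [m [b [b0 bm stepb]]] [n [c [c0 cn stepc]]].
(* The chains are glued at index [m], where [b m] and [c 0] are both [K]. The last index falls in
   the first branch only if [n = 0], and then [K = L]. *)
exists (m + n), (fun i => if i <= m then b i else c (i - m)); split=> //.
  case: ifP => [|_]; last by rewrite addKn.
  rewrite -[X in _ <= X]addn0 leq_add2l leqn0 => /eqP n0.
  by rewrite n0 addn0 bm -cn n0 c0.
move=> i lt_i; case: (ltngtP i m) => [lt_im | lt_mi | eq_im].
- exact: stepb.
- rewrite subSn ?(ltnW lt_mi) //; apply: stepc.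
  by rewrite ltn_subLR ?(ltnW lt_mi).
rewrite eq_im subSnn bm -c0; apply: stepc.
by rewrite eq_im -{1}[m]addn0 ltn_add2l in lt_i.
Qed.

Lemma KF_subnormalS {F : group_class} {gT : finGroupType} {H L K : {group gT}} :
  formation F -> hereditary F -> H \subset L -> L \subset K ->
  KF_subnormal F H K -> KF_subnormal F H L.
Proof.
move=> formF herF sHL sLK.
move/(KF_subnormal_map (fun K => K :&: L)%G)=> snI.
have -> : H = (H :&: L)%G by apply/val_inj/esym/setIidPl.
have {2}-> : L = (K :&: L)%G by apply/val_inj/esym/setIidPr.
by apply: snI => A B _; apply: KF_stepI.
Qed.

Lemma weak_KF_subnormalizer_exists (F : group_class) {gT : finGroupType}
    {G H : {group gT}} :
  H \subset G -> exists T, weak_KF_subnormalizer F G H T.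
Proof.
move=> sHG.
pose p (K : {group gT}) := (K \subset G) && `[< KF_subnormal F H K >].
have pH : p H by rewrite /p sHG; apply/asboolP/KF_subnormal_refl.
have [T /maxgroupP[/andP[sTG /asboolP snT] maxT] _] := maxgroup_exists pH.
exists T; split=> // M sMG snM sTM; apply/val_inj/esym/maxT => //.
by rewrite /p sMG; apply/asboolP.
Qed.

Lemma weak_KF_subnormalizerJ {F : group_class} {gT : finGroupType} {x : gT}
    {G H T : {group gT}} :
  formation F -> x \in G -> weak_KF_subnormalizer F G H T ->
  weak_KF_subnormalizer F G (H :^ x)%G (T :^ x)%G.
Proof.
move=> formF Gx [sTG snT maxT].
have snJ y (A B : {group gT}) :
    KF_subnormal F A B -> KF_subnormal F (A :^ y)%G (B :^ y)%G.
  by apply: (KF_subnormal_map (fun K => K :^ y)%G) => K L _; apply: KF_stepJ.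
split=> [||M sMG snM sTM]; first by rewrite -(conjGid Gx) conjSg.
  exact: snJ.
have -> : T = (M :^ x^-1)%G.
  apply: maxT; rewrite -?sub_conjg //.
    by rewrite sub_conjgV conjGid.
  have -> : H = ((H :^ x) :^ x^-1)%G by apply/val_inj; rewrite /= conjsgK.
  exact: snJ.
by apply/val_inj; rewrite /= conjsgKV.
Qed.

(** Treats both families at once. A member of [X] is needed to place the intersection inside [G];
    closure under conjugation makes it normal. *)
Lemma largest_cap_weak_KF_subnormalizers {F : group_class} {gT : finGroupType}
    {G : {group gT}} {X : {group gT} -> Prop} :
  formation F -> hereditary F -> (exists H, X H) ->
  (forall H, X H -> H \subset G) ->
  (forall x H, x \in G -> X H -> X (H :^ x)%G) ->
  largest (KF_subnormal_in_products F X G) (cap_weak_KF_subnormalizers F X G).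
Proof.
move=> formF herF [H0 XH0] subX conjX.
set S := cap_weak_KF_subnormalizers F X G.
have sST H T : X H -> weak_KF_subnormalizer F G H T -> S \subset T.
  by move=> XH wT; apply: bigcap_inf; apply/asboolP; exists H.
have sSG : S \subset G.
  have [T wT] := weak_KF_subnormalizer_exists F (subX _ XH0).
  by apply: subset_trans (sST _ _ XH0 wT) _; case: wT.
split.
  split.
    rewrite /normal sSG; apply/subsetP=> x Gx; rewrite inE.
    apply/bigcapsP=> T /asboolP[H XH wT].
    (* [S :^ x] lies in [T] as soon as [S] lies in [T :^ x^-1], which is a weak subnormalizer of
       another member of [X], namely [H :^ x^-1]. *)
    rewrite sub_conjg.
    apply: (sST _ (T :^ x^-1)%G (conjX _ _ (groupVr Gx) XH)).
    exact: weak_KF_subnormalizerJ (groupVr Gx) wT.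
  move=> H XH; have [T wT] := weak_KF_subnormalizer_exists F (subX _ XH).
  have sST' := sST _ _ XH wT; case: wT => sTG snT _.
  apply: (KF_subnormalS _ _ _ _ snT) => //; first exact: joing_subl.
  by rewrite join_subG (KF_subnormal_sub snT).
move=> N [nNG snN]; apply/bigcapsP=> T /asboolP[H XH [sTG snT maxT]].
suff -> : T = (T <*> N)%G by exact: joing_subr.
apply: maxT; last exact: joing_subl.
  by rewrite join_subG sTG normal_sub.
apply: KF_subnormal_trans (snN _ XH) _.
apply: (KF_subnormal_map (fun K => K <*> N)%G) snT => L K sKT.
exact: KF_stepY nNG (subset_trans sKT sTG).
Qed.

Theorem proposition3 (F : group_class) (formF : formation F)
    (hereditaryF : hereditary F) (gT : finGroupType) (G : {group gT}) :
  largest (KF_subnormal_in_products F (Sylow_subgroup G) G) (S_F F G) /\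
  largest (KF_subnormal_in_products F (cyclic_primary_subgroup G) G) (C_F F G).
Proof.
split; apply: largest_cap_weak_KF_subnormalizers => //.
(* Any prime would do; [P] is trivial when [G] has odd order. *)
- by have [P sylP] := Sylow_exists 2 G; exists P, 2.
- by move=> H [p _ /pHall_sub].
- by move=> x H Gx [p pr_p sylH]; exists p; rewrite //= pHallJ.
- exists 1%G; split; rewrite ?sub1G ?cyclic1 //.
  by exists 2; rewrite //= pgroup1.
- by move=> H [].
move=> x H Gx [sHG cycH [p pr_p pH]].
split; rewrite /= ?cyclicJ // ?conj_subG //.
by exists p; rewrite ?pgroupJ.
Qed.
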